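(* Let $G$ be an OD-admissible graph. (a) We have $\gamma^{\rm LD}(G)\le\gamma^{\rm OD}(G)$. (b) If $G$ has no isolated vertex, then $\gamma^{\rm LTD}(G)-1\leq\gamma^{\rm OD}(G)$.
   Context: Graphs are finite, simple and undirected. For a vertex $v$ of $G=(V,E)$, $N(v)=\{u\in V: uv\in E\}$ and $N[v]=N(v)\cup\{v\}$. A set $C\subseteq V$ is dominating if $N[v]\cap C\neq\emptyset$ for all $v\in V$; total-dominating if $N(v)\cap C\neq\emptyset$ for all $v\in V$; open-separating if $N(u)\cap C\neq N(v)\cap C$ for all distinct $u,v\in V$; locating if $N(u)\cap C\neq N(v)\cap C$ for all distinct $u,v\in V\setminus C$. An OD-code is a dominating and open-separating set; an LD-code is a dominating and locating set; an LTD-code is a total-dominating and locating set. $G$ is OD-admissible if it has an OD-code. $\gamma^{\rm X}(G)$ is the minimum cardinality of an X-code of $G$ for $X\in\{\mathrm{OD},\mathrm{LD},\mathrm{LTD}\}$. An isolated vertex is a vertex $v$ with $N(v)=\emptyset$. *)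

(* Defs.v *)
From mathcomp Require Import all_boot.

Set Implicit Arguments.
Unset Strict Implicit.
Unset Printing Implicit Defensive.

Record sgraph := SGraph {
  vertex :> finType;
  adj : rel vertex;
  adj_sym : symmetric adj;
  adj_irr : irreflexive adj
}.

Section Codes.
Variable G : sgraph.
Implicit Types (u v : G) (C : {set G}) (X : pred {set G}).

Definition nbh v : {set G} := [set u | adj u v].

Definition cnbh v : {set G} := nbh v :|: [set v].

Definition dominating C : bool := [forall v, cnbh v :&: C != set0].

Definition total_dominating C : bool := [forall v, nbh v :&: C != set0].

Definition open_separating C : bool :=
  [forall u, forall v, (u != v) ==> (nbh u :&: C != nbh v :&: C)].

Definition locating C : bool :=
  [forall u in ~: C, forall v in ~: C,
     (u != v) ==> (nbh u :&: C != nbh v :&: C)].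

Definition OD_code C : bool := dominating C && open_separating C.

Definition LD_code C : bool := dominating C && locating C.

Definition LTD_code C : bool := total_dominating C && locating C.

Definition OD_admissible : Prop := exists C, OD_code C.

Definition isolated v : bool := nbh v == set0.

(* No set has more than #|G| elements, so the default value #|G| matters only
   when no set satisfies X; otherwise this is the true minimum (gammaP). *)
Definition gamma X : nat := \big[minn/#|G|]_(C : {set G} | X C) #|C|.

Lemma gamma_le X C : X C -> gamma X <= #|C|.
Proof.
move=> XC; rewrite /gamma; have := mem_index_enum C.
elim: (index_enum _) => // D s IHs; rewrite inE big_cons.
case/predU1P=> [<-|/IHs le_s]; first by rewrite XC geq_minl.
by case: ifP => // _; rewrite geq_min le_s orbT.
Qed.

Lemma gammaP X : (exists C, X C) ->
  (exists2 C, X C & #|C| = gamma X) /\ (forall C, X C -> gamma X <= #|C|).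
Proof.
case=> C0 XC0; split; last exact: gamma_le.
have [C XC Cmin] := arg_minnP (fun C : {set G} => #|C|) XC0.
exists C => //; apply/eqP; rewrite eqn_leq gamma_le // andbT.
rewrite /gamma; elim/big_ind: _ => [|m n Cm Cn|D XD]; last exact: Cmin.
- exact: max_card.
- by rewrite leq_min Cm Cn.
Qed.

Definition gamma_OD : nat := gamma OD_code.

Definition gamma_LD : nat := gamma LD_code.

Definition gamma_LTD : nat := gamma LTD_code.

End Codes.

Arguments gamma_OD : clear implicits.
Arguments gamma_LD : clear implicits.
Arguments gamma_LTD : clear implicits.
Arguments OD_admissible : clear implicits.

(* Main.v *)
Require Import Defs.
From mathcomp Require Import all_boot.

(** Open-separating sets are locating, and both properties pass to supersets.
    An open-separating set C misses the neighbourhood of at most one vertex, so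
    adding a neighbour of that vertex makes C total-dominating. *)

Section Codes.
Set Implicit Arguments.
Unset Strict Implicit.
Variable G : sgraph.
Implicit Types C D : {set G}.

Lemma open_separating_locating C : open_separating C -> locating C.
Proof.
move=> /forallP sepC; apply/forall_inP=> u _; apply/forall_inP=> v _.
exact: (forallP (sepC u)).
Qed.

Lemma open_separatingS C D :
  C \subset D -> open_separating C -> open_separating D.
Proof.
move=> sCD /forallP sepC; apply/forallP=> u; apply/forallP=> v.
apply/implyP=> neq_uv; apply: contra (implyP (forallP (sepC u) v) neq_uv).
(* Since [C] equals [D :&: C], equal traces on [D] restrict to equal traces on [C]. *)
by move=> /eqP eqD; rewrite -(setIidPr sCD) !setIA eqD.
Qed.

Lemma open_separating_LTD_extension C :
    (forall v : G, ~~ isolated v) -> open_separating C ->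
  exists2 D : {set G}, LTD_code D & #|D| <= #|C|.+1.
Proof.
move=> noiso sepC; have [totC | ] := boolP (total_dominating C).
  by exists C; rewrite // /LTD_code totC open_separating_locating.
(* Here [v] has no neighbour in [C]; as [v] is not isolated, it has a neighbour [w] to add. *)
case/forallPn=> v /negPn/eqP vC0; have /set0Pn[w vw] := noiso v.
have sCD : C \subset w |: C by apply: subsetUr.
exists (w |: C); last by rewrite cardsU1 -add1n leq_add2r leq_b1.
rewrite /LTD_code open_separating_locating ?(open_separatingS sCD) // andbT.
apply/forallP=> x; have [-> | neq_xv] := eqVneq x v.
  by apply/set0Pn; exists w; rewrite inE vw setU11.
(* The trace of [v] on [C] is empty, so separating [x] from [v] forces [x] to have a neighbour in
   [C]. *)
have := implyP (forallP (forallP sepC x) v) neq_xv; rewrite vC0.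
by apply: contra => /eqP xD0; rewrite -subset0 -xD0 setIS.
Qed.

End Codes.

Theorem theorem4 (G : sgraph) (hG : OD_admissible G) :
  gamma_LD G <= gamma_OD G /\
  ((forall v : G, ~~ isolated v) -> gamma_LTD G - 1 <= gamma_OD G).
Proof.
(* Admissibility makes [gamma_OD G] the size of an actual code [C] rather than the default
   [#|G|]. *)
have [[C /andP[domC sepC] cardC] _] := gammaP hG.
rewrite /gamma_OD -cardC; split=> [|noiso].
  by apply: gamma_le; rewrite /LD_code domC open_separating_locating.
have [D ltdD leDC] := open_separating_LTD_extension noiso sepC.
by rewrite leq_subLR add1n (leq_trans (gamma_le ltdD)).
Qed.
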